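(* Let $r\ge 2$. Let $\gamma$ be a space-like curve parametrized by the arc length $s$ in a $2$-dimensional Lorentzian space form $N^2_1(c)$ of constant sectional curvature $c$. Assume that $\gamma$ has constant, non-zero curvature $k(s)$, say $k(s)=\kappa>0$. Then $\gamma$ is proper $r$-harmonic if and only if $$\kappa^2+(r-1)c=0.$$ In particular, when $c\ge 0$ there exists no such space-like curve (with constant non-zero curvature) which is proper $r$-harmonic.
   Context: Conventions. For a semi-Riemannian manifold $(M,\langle\,,\rangle)$ with Levi-Civita connection $\nabla$, the curvature operator is $R(X,Y)Z=\nabla_X\nabla_YZ-\nabla_Y\nabla_XZ-\nabla_{[X,Y]}Z$. For a smooth curve $\gamma:I\to M$ ($I$ an open real interval) parametrized by arc length, $T=\gamma'$ and $\langle T,T\rangle=\epsilon_1\in\{1,-1\}$; $\gamma$ is space-like if $\epsilon_1=1$. Put $\nabla_T^0T=T$, $\nabla_T^jT=\nabla_T(\nabla_T^{j-1}T)$. For $r\ge2$, $\gamma$ is $r$-harmonic if $$\tau_r(\gamma)=\nabla^{2r-1}_T T+\sum_{\ell=0}^{r-2}(-1)^\ell R\big(\nabla^{2r-3-\ell}_T T,\nabla^{\ell}_T T\big)T=0,$$ and proper $r$-harmonic if it is $r$-harmonic and not a geodesic. The Lorentzian space form $N^2_1(c)$: let $\mathbb{R}^n_t$ be $\mathbb{R}^n$ with $\langle x,y\rangle=-\sum_{i=1}^t x_iy_i+\sum_{i=t+1}^n x_iy_i$. Then $N^2_1(c)$ is $\mathbb{R}^2_1$ if $c=0$, $\{x\in\mathbb{R}^3_1:\langle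 x,x\rangle=1/c\}$ if $c>0$, and $\{x\in\mathbb{R}^3_2:\langle x,x\rangle=1/c\}$ if $c<0$, with the induced metric. Its curvature is $R(X,Y)Z=c(\langle Y,Z\rangle X-\langle X,Z\rangle Y)$. Frenet equations in the surface: $\nabla_TT=\epsilon_2k(s)N$, $\nabla_TN=-\epsilon_1k(s)T$, where $\langle N,N\rangle=\epsilon_2=\pm1$, $\langle T,N\rangle=0$, $\epsilon_1\epsilon_2=-1$, and $k(s)$ is the curvature of $\gamma$. *)

(* Defs.v *)
From HB Require Import structures.
From mathcomp Require Import all_boot all_order all_algebra.
From mathcomp Require Import all_classical all_reals all_analysis.

Set Implicit Arguments.
Unset Strict Implicit.
Unset Printing Implicit Defensive.

Import Order.TTheory GRing.Theory Num.Theory.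
Import numFieldNormedType.Exports.
Local Open Scope classical_set_scope.
Local Open Scope ring_scope.

Section LorentzianSpaceForm.
Variable R : realType.

(* the scalar product of R^n_t *)
Definition pdot (n t : nat) (x y : 'rV[R]_n) : R :=
  - (\sum_(i < n | (i < t)%N) x 0 i * y 0 i)
  + \sum_(i < n | (t <= i)%N) x 0 i * y 0 i.

Variable c : R.

(* N^2_1(c) lies in R^2_1 (c = 0), R^3_1 (c > 0) or R^3_2 (c < 0) *)
Definition amb_dim : nat := if c == 0 then 2%N else 3%N.
Definition amb_index : nat := if c < 0 then 2%N else 1%N.
Local Notation amb := 'rV[R]_amb_dim.

Definition dot (x y : amb) : R := pdot amb_index x y.

Definition space_form : set amb :=
  if c == 0 then setT else [set x | dot x x = c^-1].

Definition tangent_space (x : amb) : set amb :=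
  if c == 0 then setT else [set v | dot v x = 0].

(* Orthogonal projection onto [tangent_space x] for [x] in [space_form]: the
   normal line is spanned by x, and dot x x = 1/c.  It is the identity for
   c = 0. *)
Definition tangent_proj (x v : amb) : amb := v - (c * dot v x) *: x.

(* R(X,Y)Z, in closed form since N^2_1(c) has constant curvature c *)
Definition curv (X Y Z : amb) : amb := c *: (dot Y Z *: X - dot X Z *: Y).

Definition smooth_on (I : set R) (f : R -> amb) : Prop :=
  forall (n : nat) (s : R), I s -> derivable (derive1n n f) s 1.

Definition open_real_interval (I : set R) : Prop :=
  [/\ open I, is_interval I & I !=set0].

Definition smooth_curve (I : set R) (gamma : R -> amb) : Prop :=
  smooth_on I gamma /\ forall s, I s -> space_form (gamma s).

Definition vector_field_along (I : set R) (gamma X : R -> amb) : Prop :=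
  smooth_on I X /\ forall s, I s -> tangent_space (gamma s) (X s).

(* nabla_T X: the Levi-Civita connection of the induced metric is the tangential
   part of the flat connection of the ambient space. *)
Definition covD (gamma X : R -> amb) : R -> amb :=
  fun s => tangent_proj (gamma s) (derive1 X s).

Definition nablaT (gamma : R -> amb) (j : nat) : R -> amb :=
  iter j (covD gamma) (derive1 gamma).

Definition arc_length_param (I : set R) (gamma : R -> amb) (e1 : R) : Prop :=
  (e1 = 1 \/ e1 = -1) /\
  forall s, I s -> dot (derive1 gamma s) (derive1 gamma s) = e1.

Definition spacelike_arc_length (I : set R) (gamma : R -> amb) : Prop :=
  arc_length_param I gamma 1.

(* The sign of k depends on the choice of the unit normal field N. *)
Definition frenet (I : set R) (gamma N : R -> amb) (k : R -> R) (e1 e2 : R) :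
    Prop :=
  [/\ arc_length_param I gamma e1, vector_field_along I gamma N,
      (e2 = 1 \/ e2 = -1) /\ e1 * e2 = -1
    & forall s, I s ->
      [/\ dot (N s) (N s) = e2,
          dot (derive1 gamma s) (N s) = 0,
          covD gamma (derive1 gamma) s = (e2 * k s) *: N s
        & covD gamma N s = - (e1 * k s) *: derive1 gamma s]].

Definition has_curvature (I : set R) (gamma : R -> amb) (k : R -> R) : Prop :=
  exists (N : R -> amb) (e1 e2 : R), frenet I gamma N k e1 e2.

(* The natural-number subtractions are exact when r >= 2. *)
Definition tau (r : nat) (gamma : R -> amb) (s : R) : amb :=
  nablaT gamma (2 * r - 1)%N s +
  \sum_(l < r.-1) (-1) ^+ l *:
    curv (nablaT gamma (2 * r - 3 - l)%N s) (nablaT gamma l s) (derive1 gamma s).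

Definition r_harmonic (r : nat) (I : set R) (gamma : R -> amb) : Prop :=
  forall s, I s -> tau r gamma s = 0.

Definition geodesic (I : set R) (gamma : R -> amb) : Prop :=
  forall s, I s -> covD gamma (derive1 gamma) s = 0.

Definition proper_r_harmonic (r : nat) (I : set R) (gamma : R -> amb) : Prop :=
  r_harmonic r I gamma /\ ~ geodesic I gamma.

Definition spacelike_constant_curvature (I : set R) (gamma : R -> amb)
    (kappa : R) : Prop :=
  [/\ smooth_curve I gamma, spacelike_arc_length I gamma
    & exists k : R -> R,
        has_curvature I gamma k /\ forall s, I s -> k s = kappa].

End LorentzianSpaceForm.

(* Main.v *)
Require Import Defs.
From mathcomp Require Import all_boot all_order all_algebra.
From mathcomp Require Import all_classical all_reals all_analysis.
From mathcomp Require Import ring zify.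
Set Implicit Arguments.
Unset Strict Implicit.
Unset Printing Implicit Defensive.

Import Order.TTheory GRing.Theory Num.Theory.
Import numFieldNormedType.Exports.
Local Open Scope classical_set_scope.
Local Open Scope ring_scope.

(** Since the curvature [kappa] is constant, the Frenet equations give
    [nabla_T^(2m) T = kappa^(2m) T] and [nabla_T^(2m+1) T = - kappa^(2m+1) N].
    In each curvature term of the [r]-tension field the two indices have
    opposite parities, so exactly one of the two slots is proportional to [T],
    and every one of the [r - 1] signed terms equals [- c kappa^(2r-3) N].
    Hence the [r]-tension field is
    [- kappa^(2r-3) (kappa^2 + (r-1) c) N]. *)

Lemma dotC (R : realType) (c : R) (x y : 'rV[R]_(amb_dim c)) :
  dot x y = dot y x.
Proof.
by rewrite /dot /pdot; congr (- _ + _); apply: eq_bigr => i _; rewrite mulrC.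
Qed.

Lemma dotZl (R : realType) (c a : R) (x y : 'rV[R]_(amb_dim c)) :
  dot (a *: x) y = a * dot x y.
Proof.
rewrite /dot /pdot mulrDr mulrN !mulr_sumr.
by congr (- _ + _); apply: eq_bigr => i _; rewrite mxE mulrA.
Qed.

Lemma covDZ (R : realType) (c a : R) (gamma X : R -> 'rV[R]_(amb_dim c))
    (s : R) :
  derivable X s 1 ->
  covD gamma (fun t => a *: X t) s = a *: covD gamma X s.
Proof.
move=> dX; rewrite /covD !derive1E deriveZ //= /tangent_proj dotZl.
by rewrite scalerBr scalerA mulrCA.
Qed.

(** A derivative depends only on the germ of a field, and [I] is open. This lets formulas known only
    on [I] be differentiated again. *)
Lemma eq_covD_on (R : realType) (c : R) (I : set R)
    (gamma X Y : R -> 'rV[R]_(amb_dim c)) (s : R) :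
  open I -> {in I, X =1 Y} -> I s -> covD gamma X s = covD gamma Y s.
Proof.
move=> openI XY Is; rewrite /covD !derive1E; congr tangent_proj.
apply: near_eq_derive.
near=> t; apply: XY; rewrite inE.
by near: t; exact: open_nbhs_nbhs.
Unshelve. all: by end_near.
Qed.

(** The signs [e1] and [e2] are existentially quantified in [has_curvature]. Comparing the two
    values of [dot T T] at a point of [I] forces [e1 = 1], and then [e1 * e2 = -1] forces
    [e2 = -1]. *)
Lemma spacelike_frenet (R : realType) (c kappa : R) (I : set R)
    (gamma : R -> 'rV[R]_(amb_dim c)) :
  I !=set0 -> spacelike_constant_curvature I gamma kappa ->
  exists N : R -> 'rV[R]_(amb_dim c), forall s, I s ->
    [/\ derivable (derive1 gamma) s 1, derivable N s 1,
        [/\ dot (derive1 gamma s) (derive1 gamma s) = 1,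
            dot (N s) (N s) = -1 & dot (derive1 gamma s) (N s) = 0],
        covD gamma (derive1 gamma) s = - kappa *: N s
      & covD gamma N s = - kappa *: derive1 gamma s].
Proof.
move=> [s0 Is0] [[smooth_gamma _] [_ normT] [k [[N [e1 [e2 F]]] k_kappa]]].
case: F => -[_ normT'] [smoothN _] [_ e12] F.
have e1E : e1 = 1 by rewrite -(normT' _ Is0) normT.
have e2E : e2 = -1 by rewrite -e12 e1E mul1r.
exists N => s Is; have [normN TN covT covN] := F s Is.
split; [exact: (smooth_gamma 1%N s Is)|exact: (smoothN 0%N s Is)| | |].
- by split => //; rewrite ?normT // normN.
- by rewrite covT k_kappa // e2E mulN1r.
- by rewrite covN k_kappa // e1E mul1r.
Qed.

(** Each covariant derivative swaps [T] and [N] and contributes the same factor [- kappa], which is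
    constant and so passes through [covD]. *)
Lemma nablaT_frenet (R : realType) (c kappa : R) (I : set R)
    (gamma N : R -> 'rV[R]_(amb_dim c)) :
  open I ->
  (forall s, I s ->
    [/\ derivable (derive1 gamma) s 1, derivable N s 1,
        covD gamma (derive1 gamma) s = - kappa *: N s
      & covD gamma N s = - kappa *: derive1 gamma s]) ->
  forall (j : nat) (s : R), I s ->
  nablaT gamma j s =
    (- kappa) ^+ j *: (if odd j then N s else derive1 gamma s).
Proof.
move=> openI F; elim=> [|j IHj] s Is; first by rewrite expr0 scale1r.
have [dT dN covT covN] := F s Is.
rewrite -[LHS]/(covD gamma (nablaT gamma j) s).
pose Y t := (- kappa) ^+ j *: (if odd j then N else derive1 gamma) t.
rewrite (@eq_covD_on _ _ I _ _ Y) // => [|t]; last first.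
  by rewrite inE => It; rewrite IHj // /Y; case: (odd j).
rewrite /Y covDZ; last by case: (odd j).
by rewrite exprSr -scalerA /=; case: (odd j); rewrite /= ?covT ?covN.
Qed.

Lemma tau_frenet (R : realType) (c kappa : R) (r : nat) (I : set R)
    (gamma N : R -> 'rV[R]_(amb_dim c)) (s : R) :
  (2 <= r)%N -> open I ->
  (forall s, I s ->
    [/\ derivable (derive1 gamma) s 1, derivable N s 1,
        [/\ dot (derive1 gamma s) (derive1 gamma s) = 1,
            dot (N s) (N s) = -1 & dot (derive1 gamma s) (N s) = 0],
        covD gamma (derive1 gamma) s = - kappa *: N s
      & covD gamma N s = - kappa *: derive1 gamma s]) ->
  I s ->
  tau r gamma s =
    ((- kappa) ^+ (2 * r - 3) * (kappa ^+ 2 + (r%:R - 1) * c)) *: N s.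
Proof.
move=> hr openI F Is; have [_ _ [TT _ TN] _ _] := F s Is.
have nablaE j : nablaT gamma j s =
    (- kappa) ^+ j *: (if odd j then N s else derive1 gamma s).
  by apply: (nablaT_frenet openI) Is => t /F[].
have NT : dot (N s) (derive1 gamma s) = 0 by rewrite dotC.
have termE (l : 'I_r.-1) : (-1) ^+ l *:
    curv (nablaT gamma (2 * r - 3 - l)%N s) (nablaT gamma l s)
      (derive1 gamma s) = ((- kappa) ^+ (2 * r - 3) * c) *: N s.
  (* As [l <= r - 2], the truncated subtraction is exact; [2 * r - 3] is odd, so the two indices
     have opposite parities. *)
  have lr : (l <= 2 * r - 3)%N by case: l => /= l; lia.
  have odd_sub : odd (2 * r - 3 - l) = ~~ odd l.
    by rewrite oddB // oddB ?oddM //=; lia.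
  rewrite /curv !nablaE odd_sub -{3}(subnK lr) exprD -(signr_odd _ l).
  (* For odd [l] the slots are [T], [N] and the curvature gives [- c N], whose sign cancels against
     [(-1) ^+ l]; for even [l] they are [N], [T] and give [c N] directly. *)
  case: (odd l); rewrite /= !dotZl ?NT ?TT ?mulr0 ?mulr1 !scale0r.
    rewrite sub0r expr1 scaleN1r -!scalerN opprK !scalerA.
    by congr (_ *: _); ring.
  by rewrite subr0 expr0 scale1r !scalerA; congr (_ *: _); ring.
rewrite /tau (eq_bigr _ (fun l _ => termE l)) sumr_const card_ord nablaE.
have -> : odd (2 * r - 1) by lia.
rewrite -scaler_nat scalerA -scalerDl; congr (_ *: _).
have -> : (2 * r - 1 = 2 * r - 3 + 2)%N by lia.
have -> : r%:R = r.-1%:R + 1 :> R by rewrite natr1 prednK //; lia.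
by rewrite exprD; ring.
Qed.

(** Stated for [kappa] of either sign, so that it serves both the equivalence and the non-existence
    claim. *)
Lemma proper_r_harmonic_constant_curvature (R : realType) (c kappa : R)
    (r : nat) (I : set R) (gamma : R -> 'rV[R]_(amb_dim c)) :
  (2 <= r)%N -> open_real_interval I ->
  spacelike_constant_curvature I gamma kappa -> kappa != 0 ->
  proper_r_harmonic r I gamma <-> kappa ^+ 2 + (r%:R - 1) * c = 0.
Proof.
move=> hr [openI _ I0] gammaP kappa0.
have [N F] := spacelike_frenet I0 gammaP.
have [s0 Is0] := I0; have [_ _ [_ NN _] covT _] := F s0 Is0.
(* A zero vector cannot have square norm [-1]. *)
have N0 : N s0 != 0.
  apply/eqP => Ns0; move/eqP: NN.
  by rewrite Ns0 -(scale0r (0 : 'rV[R]_(amb_dim c))) dotZl mul0r eq_sym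
    oppr_eq0 oner_eq0.
split=> [[/(_ s0 Is0) + _]|E].
  rewrite (tau_frenet hr openI F Is0) => /eqP.
  rewrite scaler_eq0 (negbTE N0) orbF mulf_eq0 expf_eq0 oppr_eq0.
  by rewrite (negbTE kappa0) andbF => /eqP.
split=> [s Is|/(_ s0 Is0)/eqP].
  by rewrite (tau_frenet hr openI F Is) E mulr0 scale0r.
(* A geodesic would have [- kappa *: N s0 = 0], with both factors non-zero. *)
by rewrite covT scaler_eq0 oppr_eq0 (negbTE kappa0) (negbTE N0).
Qed.

Theorem theorem1p5 (R : realType) (c : R) (r : nat) (hr : (2 <= r)%N) :
  (forall (I : set R) (gamma : R -> 'rV[R]_(amb_dim c)) (kappa : R),
     open_real_interval I ->
     spacelike_constant_curvature I gamma kappa ->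
     0 < kappa ->
     (proper_r_harmonic r I gamma <-> kappa ^+ 2 + (r%:R - 1) * c = 0)) /\
  (0 <= c ->
   ~ exists (I : set R) (gamma : R -> 'rV[R]_(amb_dim c)) (kappa : R),
       [/\ open_real_interval I,
           spacelike_constant_curvature I gamma kappa,
           kappa != 0
         & proper_r_harmonic r I gamma]).
Proof.
split=> [I gamma kappa openI gammaP kappa_gt0|c0].
  by apply: proper_r_harmonic_constant_curvature => //; rewrite gt_eqF.
move=> [I [gamma [kappa [openI gammaP kappa0]]]].
move=> /(proper_r_harmonic_constant_curvature hr openI gammaP kappa0)/eqP.
(* Here [kappa ^+ 2 > 0] and [(r - 1) c >= 0], so the sum is positive. *)
apply/negP; rewrite gt_eqF // ltr_pwDl ?exprn_even_gt0 ?kappa0 ?orbT //.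
by rewrite mulr_ge0 // subr_ge0 ler1n; lia.
Qed.
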